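(* Let $G$ be a finite abelian $p$-group ($p$ prime) with exponent $q>1$, let $d=\lceil \mathsf D^*(G)/q\rceil$, let $m\geq 0$ be an integer, let $X\subseteq\mathbb N=\{1,2,\ldots\}$ be a finite set of positive integers with $|X|\geq d+m$, and let $\{x_1,\ldots,x_s\}=[1,\max X]\setminus X$ with the $x_i$ distinct. Suppose $$\prod_{i=1}^s x_i\prod_{1\leq i<j\leq s}(x_j-x_i)\not\equiv 0\pmod{p^{m+1}}.$$ Then $$\mathsf s_{X\cdot q}(G)\leq\Big(\max X-|X|+\frac{m(p-1)}{p}+1\Big)q+\mathsf D^*(G)-1\leq\Big(\max X+1-\frac mp\Big)q-r,$$ where $r\in[1,q]$ is the integer such that $d=\frac{\mathsf D^*(G)+r-1}{q}$.
   Context: If $G\cong C_{n_1}\oplus\cdots\oplus C_{n_r}$ with $1\leq n_1\mid\cdots\mid n_r$ ($C_n$ cyclic of order $n$), then $\mathsf D^*(G)=1+\sum_{i=1}^r(n_i-1)$. A sequence over $G$ is a finite unordered list (multiset) of elements of $G$; its length is its number of terms; it is zero-sum if its terms sum to $0$. For a set $Y\subseteq\mathbb N_0$, $\mathsf s_Y(G)$ is the minimal integer $\ell$ such that every sequence of $\ell$ terms from $G$ has a zero-sum subsequence whose length lies in $Y$. For $X=\{x_1,\ldots\}$ and $q\in\mathbb Z$, $X\cdot q=\{xq: x\in X\}$. $[a,b]$ denotes integers $x$ with $a\leq x\leq b$. Empty products equal $1$. *)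

(* Defs.v *)
From HB Require Import structures.
From mathcomp Require Import all_boot all_order all_algebra.
From mathcomp Require Import all_fingroup all_solvable.
From mathcomp Require Import finmap.

Set Implicit Arguments.
Unset Strict Implicit.
Unset Printing Implicit Defensive.

Import Order.TTheory GRing.Theory Num.Theory.
Local Open Scope ring_scope.

(* abelian_type lists the invariant factors n_r, ..., n_1 > 1 of the group;
   trivial factors n_i = 1 contribute nothing to the sum. *)
Definition Dstar (G : finZmodType) : nat :=
  (1 + \sum_(n <- abelian_type [set: G]) (n - 1))%N.

(* Sequences over G are unordered in the mathematics. Order does not matter
   here: the sub-multisets of a list are, up to permutation, its subseqs. *)
Definition forces_zero_sum (G : finZmodType) (Y : {pred nat}) (l : nat) : Prop :=
  forall S : seq G, size S = l ->
    exists T : seq G, [/\ subseq T S, \sum_(g <- T) g = 0 & size T \in Y].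

(* s_Y(G) = l. The minimum need not exist for arbitrary Y, hence a relation. *)
Definition is_sY (G : finZmodType) (Y : {pred nat}) (l : nat) : Prop :=
  forces_zero_sum G Y l /\
  forall k : nat, forces_zero_sum G Y k -> (l <= k)%N.

Definition fset_max (X : {fset nat}) : nat := (\max_(x <- X) x)%N.

Definition dilate (X : {fset nat}) (q : nat) : {fset nat} :=
  [fset (x * q)%N | x in X]%fset.

(* Main.v *)
Require Import Defs.
From HB Require Import structures.
From mathcomp Require Import all_boot all_order all_algebra.
From mathcomp Require Import all_fingroup all_solvable.
From mathcomp Require Import finmap zify ring.

Set Implicit Arguments.
Unset Strict Implicit.
Unset Printing Implicit Defensive.

Import Order.TTheory GRing.Theory Num.Theory.
Local Open Scope ring_scope.

(** Lift every term of the sequence to an integer vector of coordinates with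
    respect to a basis of [G], with an extra coordinate 1, and let [phi] be the
    indicator that the coordinates of a sum are divisible by the orders of the
    basis elements, times [\prod_i (l / q - x_i)] if [q] divides the last
    coordinate [l] and 0 otherwise. The iterated difference of [phi] along the
    sequence is a signed sum of [phi] over all subsequences. Modulo p^(m+1) the
    function [phi] has degree at most [(D* - 1) + ((s + 1) q - 1) + m (q - q/p)],
    so this sum vanishes as soon as the sequence is longer. If no zero-sum
    subsequence had length in [X q], only the empty subsequence would contribute,
    and p^(m+1) would divide [\prod_i x_i]. *)

(** * Iterated differences along a sequence of steps *)

Definition diff (H : nmodType) (h : H) (f : H -> int) : H -> int :=
  fun x => f (x + h) - f x.

Fixpoint diffs (H : nmodType) (hs : seq H) (f : H -> int) : H -> int :=
  if hs is h :: hs' then diffs hs' (diff h f) else f.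

Lemma eq_diffs (H : nmodType) (hs : seq H) (f g : H -> int) :
  f =1 g -> diffs hs f =1 diffs hs g.
Proof.
elim: hs f g => [|h hs IH] f g fg //=.
by apply: IH => x; rewrite /diff !fg.
Qed.

Lemma diffsD (H : nmodType) (hs : seq H) (f g : H -> int) x :
  diffs hs (fun y => f y + g y) x = diffs hs f x + diffs hs g x.
Proof.
elim: hs f g => [|h hs IH] f g //=.
by rewrite -IH; apply: eq_diffs => y; rewrite /diff; ring.
Qed.

Lemma diffsZ (H : nmodType) (hs : seq H) (a : int) (f : H -> int) x :
  diffs hs (fun y => a * f y) x = a * diffs hs f x.
Proof.
elim: hs f => [|h hs IH] f //=.
by rewrite -IH; apply: eq_diffs => y; rewrite /diff; ring.
Qed.

Lemma diffs0 (H : nmodType) (hs : seq H) (f : H -> int) :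
  f =1 (fun=> 0) -> diffs hs f =1 (fun=> 0).
Proof.
elim: hs f => [|h hs IH] f f0 //=.
by apply: IH => x; rewrite /diff !f0 subrr.
Qed.

Lemma diffs_sum (H : nmodType) (hs : seq H) (I : Type) (r : seq I)
    (a : I -> int) (F : I -> H -> int) x :
  diffs hs (fun y => \sum_(i <- r) a i * F i y) x =
  \sum_(i <- r) a i * diffs hs (F i) x.
Proof.
elim: r => [|i r IH].
  by rewrite big_nil; apply: diffs0 => y; rewrite big_nil.
rewrite big_cons -IH -diffsZ -diffsD; apply: eq_diffs => y.
by rewrite big_cons.
Qed.

Lemma diffs_shift (H : nmodType) (hs : seq H) (f : H -> int) h x :
  diffs hs (fun y => f (y + h)) x = diffs hs f (x + h).
Proof.
elim: hs f => [|k hs IH] f //=.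
by rewrite -IH; apply: eq_diffs => y; rewrite /diff addrAC.
Qed.

Lemma diffs_diff (H : nmodType) (hs : seq H) (f : H -> int) h x :
  diffs hs (diff h f) x = diff h (diffs hs f) x.
Proof.
rewrite /diff -diffs_shift -mulN1r -diffsZ -diffsD.
by apply: eq_diffs => y; rewrite mulN1r.
Qed.

Lemma diffs_cat (H : nmodType) (hs ks : seq H) (f : H -> int) :
  diffs (hs ++ ks) f = diffs ks (diffs hs f).
Proof. by elim: hs f => [|h hs IH] f /=. Qed.

Lemma diffs_comp (H K : nmodType) (chi : H -> K) (g : K -> int)
    (hs : seq H) x : {morph chi : y z / y + z} ->
  diffs hs (g \o chi) x = diffs (map chi hs) g (chi x).
Proof.
move=> chiD; elim: hs g => [|h hs IH] g //=.
by rewrite -IH; apply: eq_diffs => y; rewrite /diff /= chiD.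
Qed.

(* [diffs hs f x] is the signed sum of the values [f (x + \sum_(t <- T) t)]
   over all subsequences [T] of [hs]. *)
Lemma diffs_neq_subseq (H : nmodType) (hs : seq H) (f : H -> int) x :
    diffs hs f x != (-1) ^+ size hs * f x ->
  exists T, [/\ subseq T hs, T != [::] & f (x + \sum_(t <- T) t) != 0].
Proof.
elim: hs f => [|h hs IH] f /=; first by rewrite expr0 mul1r eqxx.
have [fh0|fh] := eqVneq (f (x + h)) 0; last first.
  by exists [:: h]; rewrite /= eqxx sub0seq big_seq1.
(* Since [f] vanishes at [x + h], [diff h f x] is [- f x], and the induction hypothesis applies to
   [diff h f]. *)
rewrite (_ : _ * f x = (-1) ^+ size hs * diff h f x); last first.
  by rewrite /diff fh0 exprS; ring.
case/IH => T [sT T0]; rewrite /diff.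
have [-> |fT] := eqVneq (f (x + \sum_(t <- T) t)) 0; last first.
  by exists T; split=> //; apply: subseq_trans sT (subseq_cons hs h).
rewrite subr0 => fTh; exists (h :: T).
by rewrite /= eqxx big_cons [h + _]addrC addrA.
Qed.

(** * Degrees modulo powers of [p] *)

(* The reduction of [f] modulo p^(v+1) has degree at most [W + v c]. *)
Definition pdeg (p c W : nat) (H : nmodType) (f : H -> int) : Prop :=
  forall v (hs : seq H) x, (W + v * c < size hs)%N ->
    (p%:Z ^+ v.+1 %| diffs hs f x)%Z.

(** Leibniz rule: each step of [hs] falls on one factor, so [a] steps hit [f] and [b] hit [g]. The
    exponents are arbitrary functions of the number of steps, so a step is absorbed by composing
    with [S]. *)
Lemma diffsM_dvd (p : nat) (H : nmodType) (hs : seq H) (f g : H -> int)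
    (e1 e2 : nat -> nat) (w : nat) :
    (forall ks x, (p%:Z ^+ e1 (size ks) %| diffs ks f x)%Z) ->
    (forall ks x, (p%:Z ^+ e2 (size ks) %| diffs ks g x)%Z) ->
    (forall a b, (a + b = size hs)%N -> (w <= e1 a + e2 b)%N) ->
  forall x, (p%:Z ^+ w %| diffs hs (fun y => f y * g y)%R x)%Z.
Proof.
elim: hs f g e1 e2 => [|h hs IH] f g e1 e2 f_e1 g_e2 we x /=.
  apply: dvdz_trans (dvdz_exp2l _ (we 0 0 erefl)%N) _.
  by rewrite exprD; apply: dvdz_mul; [apply: (f_e1 [::]) | apply: (g_e2 [::])].
have -> : diffs hs (diff h (fun y => f y * g y)) x =
    diffs hs (fun y => diff h f y * g (y + h)) x +
    diffs hs (fun y => f y * diff h g y) x.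
  by rewrite -diffsD; apply: eq_diffs => y; rewrite /diff; ring.
apply: rpredD.
  apply: (IH (diff h f) (fun y => g (y + h)) (e1 \o S) e2) => [ks y|ks y|a b ab].
  - exact: (f_e1 (h :: ks)).
  - by rewrite diffs_shift.
  - by apply: we; rewrite addSn ab.
apply: (IH f (diff h g) e1 (e2 \o S)) => [ks y|ks y|a b ab].
- exact: f_e1.
- exact: (g_e2 (h :: ks)).
- by apply: we; rewrite addnS ab.
Qed.

(** The exponent is the ceiling of [(size hs - W) / c]. It is 0 for short [hs], so the bound holds
    for every length, as [diffsM_dvd] requires. *)
Lemma pdeg_ceil (p c W : nat) (H : nmodType) (f : H -> int) : (0 < c)%N ->
  pdeg p c W f ->
  forall hs x, (p%:Z ^+ ((size hs - W + c.-1) %/ c) %| diffs hs f x)%Z.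
Proof.
move=> c0 fW hs x; set e := (_ %/ c)%N.
have := leq_divM (size hs - W + c.-1) c; rewrite -/e.
case: e => [|v] le_e; first by rewrite expr0 dvd1z.
by apply: fW; nia.
Qed.

Lemma pdegM (p c W1 W2 : nat) (H : nmodType) (f g : H -> int) : (0 < c)%N ->
    pdeg p c W1 f -> pdeg p c W2 g ->
  pdeg p c (W1 + W2) (fun x => f x * g x).
Proof.
move=> c0 f_deg g_deg v hs x lt_hs.
apply: (@diffsM_dvd p H hs f g (fun n => (n - W1 + c.-1) %/ c)%N
  (fun n => (n - W2 + c.-1) %/ c)%N) => [||a b ab].
- exact: pdeg_ceil.
- exact: pdeg_ceil.
(* The sum of two ceilings is at least the ceiling of the sum. *)
have := ltn_ceil (a - W1 + c.-1) c0; have := ltn_ceil (b - W2 + c.-1) c0.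
move: (_ %/ c)%N (_ %/ c)%N => A B ltA ltB; rewrite ltnNge; apply/negP => le_v.
have := leq_mul le_v (leqnn c); nia.
Qed.

Lemma pdeg_prod (p c : nat) (H : nmodType) (I : Type) (r : seq I)
    (W : I -> nat) (f : I -> H -> int) : (0 < c)%N ->
    (forall i, pdeg p c (W i) (f i)) ->
  pdeg p c (\sum_(i <- r) W i) (fun x => \prod_(i <- r) f i x).
Proof.
move=> c0 f_deg; elim: r => [|i r IH] v hs x.
  case: hs => // h hs _ /=; rewrite diffs0 ?dvdz0 // => y.
  by rewrite /diff !big_nil subrr.
rewrite big_cons => /(pdegM c0 (f_deg i) IH x); congr (_ %| _)%Z.
by apply: eq_diffs => y; rewrite big_cons.
Qed.

Lemma pdeg_comp (p c W : nat) (H K : nmodType) (chi : H -> K)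
    (g : K -> int) : {morph chi : y z / y + z} ->
  pdeg p c W g -> pdeg p c W (g \o chi).
Proof.
by move=> chiD gW v hs x ?; rewrite diffs_comp //; apply: gW; rewrite size_map.
Qed.

Lemma pdeg_leq (p c c' W : nat) (H : nmodType) (f : H -> int) :
  (c' <= c)%N -> pdeg p c' W f -> pdeg p c W f.
Proof.
move=> le_c fW v hs x lt_hs; apply: fW; apply: leq_ltn_trans lt_hs.
by rewrite leq_add2l leq_mul2l le_c orbT.
Qed.

(** * Unit differences on the natural numbers *)

Lemma diffs_nseq1 (n : nat) (f : nat -> int) x :
  diffs (nseq n.+1 1%N) f x =
  diffs (nseq n 1%N) f (x + 1)%N - diffs (nseq n 1%N) f x.
Proof. by rewrite /= diffs_diff. Qed.

(** A difference of step [h] telescopes into [h] translated unit differences. *)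
Lemma dvd_diffs_nat (d : int) (hs : seq nat) (f : nat -> int) :
    (forall x, (d %| diffs (nseq (size hs) 1%N) f x)%Z) ->
  forall x, (d %| diffs hs f x)%Z.
Proof.
elim: hs f => [|h hs IH] f //= d_f.
apply: IH => x; rewrite diffs_diff /diff.
elim: h => [|h IHh]; first by rewrite addr0 subrr dvdz0.
have -> : x + h.+1 = ((x + h) + 1)%N :> nat by rewrite /GRing.add /=; lia.
have := rpredD (d_f (x + h)) IHh; rewrite diffs_diff /diff.
by rewrite addrA subrK.
Qed.

Lemma Newton_forward (n : nat) (f : nat -> int) x :
  f (x + n)%N = \sum_(k < n.+1) 'C(n, k)%:Z * diffs (nseq k 1%N) f x.
Proof.
elim: n x => [|n IH] x; first by rewrite big_ord1 mul1r addn0.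
rewrite addnS -addSn IH.
under eq_bigr => k _ do
  rewrite -[x.+1]addn1 -[diffs _ _ _](subrK (diffs (nseq k 1%N) f x))
    -diffs_nseq1 mulrDr.
rewrite big_split /= [RHS]big_ord_recl /= bin0.
under [in RHS]eq_bigr => k _ do rewrite binS PoszD mulrDl.
rewrite big_split /= addrC mul1r addrA; congr (_ + _).
rewrite big_ord_recl bin0 mul1r; congr (_ + _).
by rewrite big_ord_recr /= bin_small // mul0r addr0.
Qed.

(** From [p ^ j] to [p ^ (j + i)] there are [i] increments [p ^ k - p ^ k.-1], of which the last is
    the largest. *)
Lemma leq_expn_diff (p j i : nat) : (0 < p)%N ->
  (p ^ (j + i) <= i * (p.-1 * p ^ (j + i).-1) + p ^ j)%N.
Proof.
move=> p0; elim: i => [|i IH]; first by rewrite addn0.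
rewrite addnS /=.
have le_p : (p ^ (j + i).-1 <= p ^ (j + i))%N by rewrite leq_pexp2l ?leq_pred.
have := leq_mul (leqnn (i * p.-1)) le_p.
by rewrite expnS; move: IH; nia.
Qed.

(** From [k * 'C(p ^ a, k) = p ^ a * 'C((p ^ a).-1, k.-1)] the valuation of the binomial is at least
    [a - logn p k]; then [leq_expn_diff] applies with [j = logn p k]. If a factor [p] is worth [c]
    differences, the term ['C(q, k) D^k] is thus worth at least [q] of them. *)
Lemma leq_logn_bin (p a k : nat) : prime p -> (0 < k < p ^ a)%N ->
  (p ^ a <= logn p 'C(p ^ a, k) * (p.-1 * p ^ a.-1) + k)%N.
Proof.
move=> p_pr /andP[k0 k_lt]; have p0 := prime_gt0 p_pr.
have lt_ka : (logn p k < a)%N.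
  rewrite -(ltn_exp2l _ _ (prime_gt1 p_pr)); apply: leq_ltn_trans k_lt.
  by apply: dvdn_leq => //; apply: pfactor_dvdnn.
have : (logn p k + logn p 'C(p ^ a, k) >= a)%N.
  have := mul_bin_diag (p ^ a) k.-1; rewrite prednK // => /(congr1 (logn p)).
  rewrite !lognM ?expn_gt0 ?p0 ?bin_gt0 ?(ltnW k_lt) //; last by lia.
  by rewrite pfactorK // => <-; apply: leq_addr.
move=> le_a.
have := leq_expn_diff (logn p k) (a - logn p k) p0.
rewrite subnKC ?(ltnW lt_ka) // => /leq_trans; apply; apply: leq_add.
  by rewrite leq_mul2r leq_subLR le_a orbT.
by apply: dvdn_leq => //; apply: pfactor_dvdnn.
Qed.

(** * Functions supported on the multiples of a power of [p] *)

Definition on_multiples (q : nat) (f : nat -> int) (k : nat) : int :=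
  if (q %| k)%N then f (k %/ q)%N else 0.

(* Writing [D] for the unit difference, [D^q = (E^q - 1) - \sum_(0 < k < q)
   'C(q, k) D^k]. On [on_multiples q f] the operator [E^q - 1] lowers the
   degree of [f], and the terms of the sum gain powers of [p]. *)
Lemma dvd_diffs_on_multiples (p a : nat) (c := (p.-1 * p ^ a.-1)%N) :
    prime p ->
  forall n (S v : nat) (f : nat -> int) x,
    diffs (nseq S 1%N) f =1 (fun=> 0) ->
    (S * p ^ a + v * c <= n)%N ->
  (p%:Z ^+ v.+1 %| diffs (nseq n 1%N) (on_multiples (p ^ a) f) x)%Z.
Proof.
move=> p_pr; set q := (p ^ a)%N.
have q0 : (0 < q)%N by rewrite expn_gt0 prime_gt0.
elim/ltn_ind => n IH [|S] v f x fS le_n.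
  rewrite diffs0 ?dvdz0 // => k; rewrite /on_multiples.
  by case: ifP => // _; apply: fS.
pose g := on_multiples q f.
have gq y : diffs (nseq q 1%N) g y =
    on_multiples q (diff 1%N f) y +
    \sum_(k <- iota 1 q.-1) - 'C(q, k)%:Z * diffs (nseq k 1%N) g y.
  have gE : g (y + q)%N = g y + \sum_(k <- iota 1 q.-1)
      'C(q, k)%:Z * diffs (nseq k 1%N) g y + diffs (nseq q 1%N) g y.
    rewrite Newton_forward -(big_mkord xpredT
      (fun k => 'C(q, k)%:Z * diffs (nseq k 1%N) g y)) big_nat_recr //=.
    by rewrite binn mul1r big_ltn // bin0 mul1r /index_iota subn1.
  have -> : on_multiples q (diff 1%N f) y = g (y + q)%N - g y.
    rewrite /g /on_multiples dvdn_addl //; case: ifP => [/dvdnP[z ->]|_] //.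
    by rewrite -mulSnr !mulnK // /diff [z + _]addn1.
  by under eq_bigr do rewrite mulNr; rewrite sumrN gE; ring.
have -> : n = (q + (n - q))%N by rewrite subnKC //; nia.
rewrite nseqD diffs_cat -/g (eq_diffs _ gq) diffsD diffs_sum.
apply: rpredD.
  (* [diff 1 f] is killed by one difference fewer, which pays for the [q] differences spent. *)
  by apply: (IH (n - q)%N _ S) => //; nia.
rewrite big_seq; apply: rpred_sum => k.
rewrite mem_iota add1n prednK // => /andP[k0 lt_kq].
rewrite mulNr rpredN -diffs_cat -nseqD.
have := leq_logn_bin p_pr (a := a) (k := k); rewrite -/q k0 lt_kq => /(_ isT).
rewrite -/c; set e := logn p _ => le_q.
have pe : (p%:Z ^+ e %| 'C(q, k)%:Z)%Z.
  by rewrite dvdzE abszX; apply: pfactor_dvdnn.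
case: (ltnP v e) => [lt_ve|le_ev].
  by apply/dvdz_mulr/(dvdz_trans _ pe)/dvdz_exp2l.
(* The binomial supplies [p ^ e]. The remaining [k + (n - q) < n] differences supply the rest, as
   [q <= e * c + k]. *)
rewrite -(subnKC le_ev) -addnS exprD; apply: dvdz_mul => //.
apply: (IH _ _ S.+1) => //; first by lia.
have := mulnBl v e c; have := leq_mul le_ev (leqnn c); nia.
Qed.

Lemma pdeg_on_multiples (p a S : nat) (f : nat -> int) : prime p ->
    diffs (nseq S.+1 1%N) f =1 (fun=> 0) ->
  pdeg p (p.-1 * p ^ a.-1)%N (S.+1 * p ^ a).-1 (on_multiples (p ^ a) f).
Proof.
move=> p_pr fS v hs x lt_hs; apply: dvd_diffs_nat => y.
apply: (dvd_diffs_on_multiples p_pr _ fS).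
have : (0 < S.+1 * p ^ a)%N by rewrite muln_gt0 expn_gt0 (prime_gt0 p_pr).
by move: lt_hs; case: (S.+1 * p ^ a)%N.
Qed.

(** Leibniz rule with a linear factor, whose second differences vanish. At [n = 0] the truncated
    [n.-1] has coefficient 0. *)
Lemma diffs_mul_linear (n : nat) (z : int) (g : nat -> int) y :
  diffs (nseq n 1%N) (fun j => (j%:Z - z) * g j) y =
  (y%:Z + n%:Z - z) * diffs (nseq n 1%N) g y
    + n%:Z * diffs (nseq n.-1 1%N) g y.
Proof.
elim: n y => [|n IH] y; first by rewrite mul0r !addr0.
rewrite !diffs_nseq1 !IH; case: n {IH} => [|n]; first by rewrite /= !PoszD; ring.
by rewrite !diffs_nseq1 -[n.+2]addn1 !PoszD; ring.
Qed.

Lemma diffs_prod_linear (z : seq int) :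
  diffs (nseq (size z).+1 1%N) (fun j => \prod_(t <- z) (j%:Z - t)) =1 (fun=> 0).
Proof.
elim: z => [|t z IH] y; first by rewrite /= /diff !big_nil subrr.
rewrite (@eq_diffs _ _ _ (fun j => (j%:Z - t) * \prod_(u <- z) (j%:Z - u))).
  by rewrite diffs_mul_linear diffs_nseq1 !IH subrr mulr0 mulr0 addr0.
by move=> j; rewrite big_cons.
Qed.

(** * From group elements to coordinate vectors *)

(** Coordinates are natural numbers, determined only modulo the orders. The finite function and the
    boolean equality allow [xchoose] to select them. *)
Lemma Dstar_basis (p : nat) (G : finZmodType) : (p.-group [set: G])%g ->
  exists r (b : 'I_r -> G) (a : 'I_r -> nat),
    [/\ forall i, #[b i]%g = (p ^ a i)%N,
        Dstar G = (\sum_i (p ^ a i - 1)).+1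
      & forall g, exists e : {ffun 'I_r -> nat}, g == \sum_i b i *+ e i].
Proof.
move=> pG; have [b defG ob] := abelian_structure (FinRing.zmod_abelian [set: G]).
have a_ex (i : 'I_(size b)) : exists k, #[b`_i]%g = (p ^ k)%N.
  have /p_natP[k ->] : p.-nat #[b`_i]%g by apply: mem_p_elt pG (in_setT _).
  by exists k.
have [a aE] := fin_all_exists a_ex.
exists (size b), (fun i => b`_i), a; split=> // [|g].
  rewrite /Dstar add1n -ob big_map (big_nth 0) big_mkord; congr _.+1.
  by apply: eq_bigr => i _; rewrite aE.
have : g \in [set: G] by rewrite inE.
rewrite -(bigdprodW defG) (big_nth 0) big_mkord => /prodsgP[c c_in ->].
have e_ex i : exists k, c i = b`_i *+ k.
  by have /cycleP[k ->] := c_in i isT; exists k.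
have [e eE] := fin_all_exists e_ex.
exists (finfun e); apply/eqP; apply: eq_bigr => i _.
by rewrite ffunE eE.
Qed.

Lemma zero_sum_subseq (p a m : nat) (G : finZmodType) (z : seq nat)
    (S : seq G) :
    prime p -> (p.-group [set: G])%g -> exponent [set: G] = (p ^ a)%N ->
    ~~ (p ^ m.+1 %| \prod_(n <- z) n)%N ->
    ((Dstar G).-1 + (size z).+1 * p ^ a + m * (p.-1 * p ^ a.-1) <= size S)%N ->
  exists T : seq G, [/\ subseq T S, T != [::], \sum_(g <- T) g = 0,
    (p ^ a %| size T)%N & (size T %/ p ^ a)%N \notin z].
Proof.
move=> p_pr pG expG z_ndvd le_S.
have [r [b [ab [ob DE coord]]]] := Dstar_basis pG.
pose emb (g : G) := (xchoose (coord g), 1%N).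
pose c := (p.-1 * p ^ a.-1)%N.
have c0 : (0 < c)%N by rewrite muln_gt0 expn_gt0 -ltnS prednK prime_gt0 ?prime_gt1.
pose f (j : nat) := \prod_(t <- map Posz z) (j%:Z - t).
pose phi (h : {ffun 'I_r -> nat} * nat) : int :=
  (\prod_i on_multiples (p ^ ab i) (fun=> 1) (h.1 i)) * on_multiples (p ^ a) f h.2.
have phi_deg : pdeg p c (\sum_i (p ^ ab i - 1) + ((size z).+1 * p ^ a).-1) phi.
  apply: pdegM => //.
    apply: pdeg_prod => // i.
    apply: (pdeg_comp (chi := fun h : {ffun 'I_r -> nat} * nat => h.1 i)).
      by move=> h k; rewrite ffunE.
    (* The order of [b i] divides the exponent, so its own constant is at most the common [c]. *)
    apply: (@pdeg_leq p _ (p.-1 * p ^ (ab i).-1)).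
      rewrite leq_mul2l leq_pexp2l ?orbT ?(prime_gt0 p_pr) //.
      have : (p ^ ab i <= p ^ a)%N.
        apply: dvdn_leq; first by rewrite expn_gt0 (prime_gt0 p_pr).
        by rewrite -ob -expG dvdn_exponent ?inE.
      by rewrite leq_exp2l ?prime_gt1 //; lia.
    rewrite subn1; have := @pdeg_on_multiples p (ab i) 0 (fun=> 1) p_pr.
    by rewrite mul1n; apply=> y; rewrite /= /diff subrr.
  apply: (pdeg_comp (chi := fun h : {ffun 'I_r -> nat} * nat => h.2)) => //.
  apply: pdeg_on_multiples => //.
  by have := diffs_prod_linear (map Posz z); rewrite size_map.
have phi0 : phi 0 = (-1) ^+ size z * (\prod_(n <- z) n)%N%:Z.
  rewrite /phi big1 => [|i _]; last by rewrite ffunE /on_multiples dvdn0.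
  rewrite mul1r /on_multiples dvdn0 div0n /f big_map.
  elim: (z) => [|n u IH]; first by rewrite !big_nil.
  by rewrite !big_cons IH /= exprS PoszM; ring.
(* Otherwise the degree bound with [v = m] would make [p ^ m.+1] divide [phi 0], which is the
   product of [z] up to sign. *)
have /diffs_neq_subseq[T' [sT' T'0]] :
    diffs (map emb S) phi 0 != (-1) ^+ size (map emb S) * phi 0.
  apply: contra z_ndvd => /eqP phiE.
  have /phi_deg : (\sum_i (p ^ ab i - 1) + ((size z).+1 * p ^ a).-1 + m * c <
    size (map emb S))%N.
    have : (0 < (size z).+1 * p ^ a)%N by rewrite muln_gt0 expn_gt0 (prime_gt0 p_pr).
    by rewrite size_map; move: le_S; rewrite DE -/c; lia.
  move=> /(_ 0); rewrite phiE phi0 mulrA -exprD.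
  by rewrite !dvdzE abszM !abszX /= exp1n mul1n.
have [T sT eT] : exists2 T, subseq T S & T' = map emb T.
  have /subseqP[k] := sT'; rewrite size_map -map_mask => sk ->.
  by exists (mask k S) => //; apply: mask_subseq.
have sum1 i : (\sum_(t <- T') t).1 i = (\sum_(g <- T) (emb g).1 i)%N.
  rewrite eT; elim: (T) => [|g U IH]; first by rewrite !big_nil ffunE.
  by rewrite /= !big_cons /= ffunE IH.
have sum2 : (\sum_(t <- T') t).2 = size T.
  rewrite eT; elim: (T) => [|g U IH]; first by rewrite !big_nil.
  by rewrite /= !big_cons /= IH.
rewrite add0r mulf_eq0 negb_or sum2 => /andP[/prodf_neq0 phi1 phi2].
exists T; split=> //.
- by apply: contra T'0; rewrite eT => /eqP ->.
- have embE g : g = \sum_i b i *+ (emb g).1 i by apply/eqP/(xchooseP (coord g)).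
  rewrite (eq_bigr _ (fun g _ => embE g)).
  rewrite exchange_big big1 //= => i _; rewrite sumrMnr -sum1.
  have := phi1 i isT; rewrite /on_multiples; case: ifP => // /dvdnP[k ->] _.
  have b0 : b i *+ p ^ ab i = 0 by rewrite -ob; apply: (expg_order (b i)).
  by rewrite mulnC mulrnA b0 mul0rn.
- by move: phi2; rewrite /on_multiples; case: ifP.
move: phi2; rewrite /on_multiples; case: ifP => // _; apply: contra => zT.
by rewrite /f big_map (big_rem _ zT) /= subrr mul0r.
Qed.

(** * Existence of the minimum and the two bounds *)

(** There are finitely many sequences of a given length and finitely many masks, so the property is
    decidable and a least length can be extracted. *)
Lemma is_sY_exists (G : finZmodType) (Y : {pred nat}) (n : nat) :
  forces_zero_sum G Y n -> exists2 l, is_sY G Y l & (l <= n)%N.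
Proof.
pose P l := [forall S : l.-tuple G, exists k : l.-tuple bool,
  (\sum_(g <- mask k S) g == 0) && (size (mask k S) \in Y)].
have PP l : reflect (forces_zero_sum G Y l) (P l).
  apply: (iffP forallP) => [PS S Sl | FS S].
    have := PS (tcast Sl (in_tuple S)); rewrite val_tcast /=.
    move=> /existsP[k /andP[/eqP k0 kY]].
    by exists (mask k S); split=> //; apply: mask_subseq.
  have [T [/subseqP[k k_size ->] T0 TY]] := FS S (size_tuple S).
  rewrite size_tuple in k_size.
  by apply/existsP; exists (Tuple (introT eqP k_size)); rewrite /= T0 eqxx.
move=> /PP Pn; have exP : exists l, P l by exists n.
exists (ex_minn exP); case: ex_minnP => l /PP Pl le_l; last exact: le_l.
by split=> // k /PP; apply: le_l.
Qed.

Theorem theorem1p7 (p q d m r s : nat) (G : finZmodType) (X : {fset nat})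
    (x : 'I_s -> nat)
    (hp : prime p)
    (hG : (p.-group [set: G])%g)
    (hexp : exponent [set: G] = q)
    (hq : (1 < q)%N)
    (hd : d%:Z = Num.ceil ((Dstar G)%:R / q%:R : rat))
    (hXpos : forall n : nat, n \in X -> (0 < n)%N)
    (hXcard : (d + m <= #|` X|)%N)
    (hxinj : injective x)
    (hx : forall n : nat,
       (n \in codom x) = (1 <= n <= fset_max X)%N && (n \notin X))
    (hprod : ((\prod_(i < s) (x i)%:Z) *
              (\prod_(i < s) \prod_(j < s | (i < j)%N) ((x j)%:Z - (x i)%:Z))
                != 0 %[mod (p ^ m.+1)%N])%Z)
    (hr : (1 <= r <= q)%N)
    (hdr : d%:R = ((Dstar G)%:R + r%:R - 1) / q%:R :> rat) :
  exists l : nat,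
    is_sY G (mem (dilate X q)) l /\
    (let B : rat :=
       ((fset_max X)%:R - #|` X|%:R + m%:R * (p%:R - 1) / p%:R + 1) * q%:R
         + (Dstar G)%:R - 1 in
     l%:R <= B /\
     B <= ((fset_max X)%:R + 1 - m%:R / p%:R) * q%:R - r%:R).
Proof.
have X_le n : n \in X -> (n <= fset_max X)%N.
  by move=> nX; apply: (@leq_bigmax_seq _ (enum_fset X) xpredT id n nX).
(* The [x_i] followed by the elements of [X] enumerate [[1, max X]]. *)
have card_X : fset_max X = (s + #|` X|)%N.
  rewrite -[LHS](size_iota 1) -[s in RHS]card_ord -(size_codom x) -size_cat.
  apply/perm_size/uniq_perm; first exact: iota_uniq.
    rewrite cat_uniq fset_uniq andbT; apply/andP; split.
      exact/injectiveP.
    by apply/hasPn => n nX; rewrite /= hx nX andbF.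
  move=> n; rewrite mem_iota mem_cat hx add1n ltnS.
  case nX: (n \in X); last by rewrite andbT orbF.
  by rewrite hXpos // X_le.
have [a qE] : exists a, q = (p ^ a)%N.
  have /p_natP[a ->] : p.-nat q by rewrite -hexp pnat_exponent.
  by exists a.
have {qE} [b qE] : exists b, q = (p ^ b.+1)%N.
  by case: a qE hq => [->|b -> _] //; exists b.
have q_gt0 : (0 < q)%N by apply: ltnW.
have D_gt0 : (0 < Dstar G)%N by [].
have dq : (d * q + 1 = Dstar G + r)%N.
  apply/eqP; rewrite -(eqr_nat rat) natrD natrM hdr natrD.
  by rewrite divfK ?subrK // pnatr_eq0 -lt0n.
have z_ndvd : ~~ (p ^ m.+1 %| \prod_(n <- codom x) n)%N.
  apply: contra hprod => z_dvd.
  rewrite eqz_mod_dvd subr0 dvdz_mulr //.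
  move: z_dvd; rewrite codomE big_map big_enum /= dvdzE; congr (_ %| _)%N.
  by rewrite (big_morph absz abszM (erefl : `|1%Z| = 1)%N).
pose L := ((Dstar G).-1 + s.+1 * q + m * (p.-1 * p ^ b))%N.
(* This keeps the quotient by [q] of the length of a subsequence at most [max X]; outside [codom x]
   and positive, it must then lie in [X]. *)
have L_lt : (L < (fset_max X).+1 * q)%N.
  rewrite /L card_X; have := leq_mul hXcard (leqnn q).
  have : (p.-1 * p ^ b <= q)%N by rewrite qE expnS leq_mul2r leq_pred orbT.
  by move/(leq_mul (leqnn m)); nia.
have forces_L : forces_zero_sum G (mem (dilate X q)) L.
  move=> S S_size.
  have [||T [sT T0 sumT q_dvd T_size]] := @zero_sum_subseq p b.+1 m G (codom x) S
    hp hG _ z_ndvd.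
  - by rewrite hexp.
  - by rewrite size_codom card_ord -qE S_size.
  rewrite -qE in q_dvd T_size; exists T; split=> //.
  rewrite -(divnK q_dvd) /=; apply: in_imfset.
  move: T_size; rewrite hx; case: (_ \in X) => //; rewrite andbT => /negP[].
  rewrite divn_gt0 // dvdn_leq //= ?lt0n ?size_eq0 //.
  by rewrite -ltnS ltn_divLR // (leq_ltn_trans _ L_lt) // -S_size size_subseq.
have [l sYl le_lL] := is_sY_exists forces_L.
exists l; split=> //=.
have p_neq0 : p%:R != 0 :> rat by rewrite pnatr_eq0 -lt0n prime_gt0.
(* [L] is exactly the first bound, because [p ^ b = q / p]. *)
have LE : L%:R = ((fset_max X)%:R - #|` X|%:R + m%:R * (p%:R - 1) / p%:R + 1)
    * q%:R + (Dstar G)%:R - 1 :> rat.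
  rewrite -[Dstar G in RHS]prednK // -natr1 /L; move: (Dstar G).-1 => D.
  rewrite card_X qE expnS -subn1 -[s.+1]addn1.
  by rewrite !(natrD, natrM) natrB ?prime_gt0 //; field.
have DE : (Dstar G)%:R = d%:R * q%:R + 1 - r%:R :> rat.
  by rewrite -natrM -(natrD _ _ 1%N) dq natrD addrK.
rewrite -LE ler_nat le_lL; split=> //; rewrite LE DE -subr_ge0.
(* The gap between the two bounds is [q] times the excess of the size of [X] over [d + m]. *)
rewrite (_ : _ - _ = (#|` X|%:R - (d + m)%:R) * q%:R); last by rewrite natrD; field.
by rewrite mulr_ge0 ?ler0n // subr_ge0 ler_nat.
Qed.
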